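(* Let $0<\lambda_-<\lambda_+<\infty$ and let $S$ be a real symmetric positive semidefinite $d\times d$ matrix with spectral decomposition $S=U\operatorname{diag}(s_1,\dots,s_d)U^\top$, $U$ orthogonal, $s_j\ge0$. Then the unique minimizer of $$\Sigma\mapsto f_S(\Sigma)=\log\det\Sigma+\operatorname{tr}(S\Sigma^{-1})\qquad\text{over}\qquad\mathcal K=\{\Sigma\in\mathcal S^{++}(d):\lambda_- I\preceq\Sigma\preceq\lambda_+ I\}$$ is $$\widetilde\Sigma(S)=U\operatorname{diag}(\widetilde s_1,\dots,\widetilde s_d)U^\top,\qquad\widetilde s_j=\min\{\lambda_+,\max\{\lambda_-,s_j\}\}.$$ Equivalently, $\widetilde\Sigma(S)=g(S)$ by functional calculus, where $g(s)=\min\{\lambda_+,\max\{\lambda_-,s\}\}$.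
   Context: Here $d\ge2$, $\mathcal S^{++}(d)$ is the set of real symmetric positive definite $d\times d$ matrices, $I$ is the identity matrix, and $\preceq$ is the Loewner order. *)

(* Defs.v *)
From mathcomp Require Import all_boot all_order all_algebra.
From mathcomp Require Import all_classical all_reals all_analysis.

Set Implicit Arguments.
Unset Strict Implicit.
Unset Printing Implicit Defensive.

Import Order.TTheory GRing.Theory Num.Theory.

Local Open Scope classical_set_scope.
Local Open Scope ring_scope.

Definition quadform (R : realType) (d : nat) (A : 'M[R]_d) (x : 'cV[R]_d) : R :=
  (x^T *m A *m x) ord0 ord0.

Definition possemidef (R : realType) (d : nat) (A : 'M[R]_d) : Prop :=
  A^T = A /\ forall x : 'cV[R]_d, 0 <= quadform A x.

Definition posdef (R : realType) (d : nat) (A : 'M[R]_d) : Prop :=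
  A^T = A /\ forall x : 'cV[R]_d, x != 0 -> 0 < quadform A x.

Definition loewner_le (R : realType) (d : nat) (A B : 'M[R]_d) : Prop :=
  possemidef (B - A).

Definition orthogonal_mx (R : realType) (d : nat) (U : 'M[R]_d) : Prop :=
  U^T *m U = 1%:M.

Definition spectral_decomposition (R : realType) (d : nat)
    (S U : 'M[R]_d) (s : 'rV[R]_d) : Prop :=
  orthogonal_mx U /\ S = U *m diag_mx s *m U^T.

(* [g(S)] for symmetric [S]: apply [g] to the eigenvalues in some spectral
   decomposition of [S], picked by choice; the value does not depend on the
   decomposition. It is the junk value [0] when [S] is not symmetric. *)
Definition functional_calculus (R : realType) (d : nat)
    (g : R -> R) (S : 'M[R]_d) : 'M[R]_d :=
  xget 0 [set T | exists (U : 'M[R]_d) (s : 'rV[R]_d),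
    spectral_decomposition S U s /\ T = U *m diag_mx (map_mx g s) *m U^T].

Definition argmin (R : realType) (T : Type) (f : T -> R) (K : set T) : set T :=
  [set x | K x /\ forall y, K y -> f x <= f y].

(* [ln] and [invmx] are total; on positive definite [Sigma] they have their
   usual meaning, since then [\det Sigma > 0]. *)
Definition logdet_trace (R : realType) (d : nat) (S Sigma : 'M[R]_d) : R :=
  ln (\det Sigma) + \tr (S *m invmx Sigma).

Definition loewner_interval (R : realType) (d : nat) (lm lp : R) :
    set 'M[R]_d :=
  [set Sigma | [/\ posdef Sigma, loewner_le lm%:M Sigma
                 & loewner_le Sigma lp%:M]].

Definition clip (R : realType) (lm lp s : R) : R := Num.min lp (Num.max lm s).

(* Main.v *)
(* With P = U^T Sigma^-1 U, the objective is -log det P + sum_j s_j P_jj. By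
   Hadamard's inequality this is at least sum_j (s_j P_jj - log P_jj), with
   equality only for diagonal P. The constraint on Sigma puts each P_jj in
   [1/lambda_+, 1/lambda_-], where p |-> s_j p - log p has the unique minimizer
   1/clip(s_j). *)

Require Import Defs.
From mathcomp Require Import all_boot all_order all_algebra.
From mathcomp Require Import all_classical all_reals all_analysis.
From mathcomp Require Import ring lra.

Import Order.TTheory GRing.Theory Num.Theory.

Local Open Scope classical_set_scope.
Local Open Scope ring_scope.

(** The differences [F i - E i] are nonnegative and their sum is nonpositive, so each is zero. This
    settles the equality case of Hadamard's inequality and the uniqueness of the minimizer. *)
Lemma sum_le_eq (R : numDomainType) (I : finType) (E F : I -> R) :
  (forall i, E i <= F i) -> \sum_i F i <= \sum_i E i -> forall i, E i = F i.
Proof.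
move=> leEF leFE i; apply/eqP; rewrite eq_sym -subr_eq0; apply/eqP.
apply: (psumr_eq0P (P := predT) (F := fun i => F i - E i)) => //.
  by move=> j _; rewrite subr_ge0.
by apply/eqP; rewrite sumrB eq_le subr_le0 leFE subr_ge0 ler_sum.
Qed.

(** * Schur complements and Hadamard's inequality *)

Lemma posdef_conj (R : realType) (d : nat) (A W : 'M[R]_d) :
  W \in unitmx -> posdef A -> posdef (W^T *m A *m W).
Proof.
move=> uW [symA posA]; split; first by rewrite !trmx_mul trmxK symA mulmxA.
move=> x nx0; rewrite /quadform.
have -> : x^T *m (W^T *m A *m W) *m x = (W *m x)^T *m A *m (W *m x).
  by rewrite trmx_mul !mulmxA.
apply: posA; apply: contraNneq nx0 => /(congr1 (mulmx (invmx W))).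
by rewrite mulKmx // mulmx0 => ->.
Qed.

Lemma posdef_diag_gt0 (R : realType) (d : nat) (A : 'M[R]_d) (j : 'I_d) :
  posdef A -> 0 < A j j.
Proof.
move=> [_ /(_ (delta_mx j 0))]; rewrite /quadform trmx_delta -rowE -colE !mxE.
apply; apply/eqP => /matrixP/(_ j 0); rewrite !mxE !eqxx => /eqP.
by rewrite oner_eq0.
Qed.

Lemma posdef_block_diag (R : realType) (m n : nat) (a : 'M[R]_m) (C : 'M[R]_n) :
  posdef (block_mx a 0 0 C) -> posdef C.
Proof.
move=> [+ posA]; rewrite tr_block_mx => /eq_block_mx [_ _ _ symC].
split=> // y ny0; have := posA (col_mx 0 y).
rewrite /quadform tr_col_mx mul_row_block !trmx0 !mulmx0 !mul0mx !add0r.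
rewrite mul_row_col mul0mx add0r; apply.
by apply: contraNneq ny0 => /eqP; rewrite col_mx_eq0 => /andP[].
Qed.

Section SchurComplement.
Variables (R : realType) (n : nat) (A : 'M[R]_(1 + n)).
Hypothesis posA : posdef A.

Let a := A (lshift n ord0) (lshift n ord0).
Let v := ursubmx A.
Definition schur_compl : 'M[R]_n :=
  drsubmx A - (a^-1) *: (v^T *m v).

Let a_gt0 : 0 < a. Proof. exact: posdef_diag_gt0. Qed.

(** One step of symmetric Gaussian elimination: congruence by this unipotent matrix clears the first
    row and column of [A] outside the corner [a]. *)
Let L : 'M[R]_(1 + n) := block_mx 1%:M (- a^-1 *: v) 0 1%:M.

Let detL : \det L = 1.
Proof. by rewrite det_ublock !det1 mulr1. Qed.

Let A_block : A = block_mx a%:M v v^T (drsubmx A).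
Proof.
rewrite -[LHS]submxK; congr block_mx.
  by apply/matrixP=> i j; rewrite !ord1 !mxE eqxx.
by rewrite /v trmx_ursub posA.1.
Qed.

Let L_conj : L^T *m A *m L = block_mx a%:M 0 0 schur_compl.
Proof.
rewrite [in LHS]A_block /L tr_block_mx !trmx1 !trmx0 !mulmx_block.
have na0 : a != 0 by rewrite gt_eqF.
have trv : (- a^-1 *: v)^T = - a^-1 *: v^T by rewrite linearZ.
have E1 : a * - a^-1 = -1 by rewrite mulrN divff.
rewrite !(mul1mx, mul0mx, mulmx1, mulmx0, addr0, add0r) trv.
rewrite !mul_mx_scalar mul_scalar_mx !scalerA E1 !scaleN1r !addNr mul0mx add0r.
by congr block_mx; rewrite /schur_compl -scalemxAl scaleNr addrC.
Qed.

Lemma posdef_schur : posdef schur_compl.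
Proof.
apply: (@posdef_block_diag _ 1 _ a%:M); rewrite -L_conj.
by apply: posdef_conj => //; rewrite unitmxE detL unitr1.
Qed.

Lemma det_schur : \det A = a * \det schur_compl.
Proof.
have := congr1 determinant L_conj.
by rewrite !det_mulmx det_tr detL mulr1 mul1r det_ublock det_scalar1.
Qed.

Lemma schur_diag j :
  schur_compl j j = A (rshift 1 j) (rshift 1 j)
    - a^-1 * A (lshift n ord0) (rshift 1 j) ^+ 2.
Proof. by rewrite !mxE big_ord1 !mxE expr2. Qed.

Lemma schur_offdiag i j : A (lshift n ord0) (rshift 1 i) = 0 ->
  schur_compl i j = A (rshift 1 i) (rshift 1 j).
Proof. by move=> v0; rewrite !mxE big_ord1 !mxE v0 mul0r mulr0 subr0. Qed.

End SchurComplement.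

(** Induction on [d]: with corner a, rest of the first row v and Schur complement C, det A = a det
    C, while C_jj = A_jj - v_j^2 / a <= A_jj. Equality forces v = 0 and, by induction, a diagonal
    C. *)
Lemma hadamard (R : realType) (d : nat) (A : 'M[R]_d) : posdef A ->
  [/\ 0 < \det A, ln (\det A) <= \sum_j ln (A j j) &
      \sum_j ln (A j j) <= ln (\det A) -> forall i j, i != j -> A i j = 0].
Proof.
elim: d A => [|n IHn] A posA.
  by rewrite det_mx00 ln1 big_ord0; split=> // _ [].
have [detC_gt0 leC eqC] := IHn _ (posdef_schur _ _ _ posA).
pose l : 'I_(1 + n) := lshift n ord0; pose r j : 'I_(1 + n) := rshift 1 j.
have a_gt0 : 0 < A l l by apply: posdef_diag_gt0.
have Cgt0 j := posdef_diag_gt0 _ _ _ j (posdef_schur _ _ _ posA).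
have Bgt0 j := posdef_diag_gt0 _ _ _ (r j) posA.
have leCB j : schur_compl R n A j j <= A (r j) (r j).
  rewrite schur_diag gerBl mulr_ge0 ?sqr_ge0 // invr_ge0; exact: ltW.
have leln j : ln (schur_compl R n A j j) <= ln (A (r j) (r j)).
  by rewrite ler_ln ?posrE ?Cgt0 ?Bgt0.
have sumE : \sum_j ln (A j j) = ln (A l l) + \sum_j ln (A (r j) (r j)).
  by rewrite (@big_split_ord _ _ _ 1 n) big_ord1.
have lnE : ln (\det A) = ln (A l l) + ln (\det (schur_compl R n A)).
  by rewrite (det_schur _ _ _ posA) lnM // posrE.
rewrite lnE sumE; split.
- by rewrite (det_schur _ _ _ posA) mulr_gt0.
- rewrite lerD2l; apply: le_trans leC _; exact: ler_sum.
rewrite lerD2l => leBC.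
(* Over the trailing indices, sum ln A_jj <= ln det C <= sum ln C_jj, so every bound in [leln] is an
   equality; this leaves v_j^2 / a = 0. *)
have eqlnCB := sum_le_eq _ _ _ _ leln (le_trans leBC leC).
have v0 j : A l (r j) = 0.
  have /ln_inj := eqlnCB j; rewrite !posrE => /(_ (Cgt0 j) (Bgt0 j)).
  rewrite schur_diag -[RHS]subr0 => /addrI/oppr_inj/eqP.
  by rewrite mulf_eq0 invr_eq0 gt_eqF //= sqrf_eq0 => /eqP.
have diagC := eqC (le_trans (ler_sum _ (fun j _ => leln j)) leBC).
have symA i j : A i j = A j i by rewrite -{1}posA.1 mxE.
move=> i j; case: (@split_ordP 1 n i) => i' ->; case: (@split_ordP 1 n j) => j' ->.
- by rewrite !ord1 eqxx.
- by rewrite (ord1 i') v0.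
- by rewrite (ord1 j') symA v0.
move=> nij; have nij' : i' != j' by apply: contraNneq nij => ->.
by rewrite -(diagC _ _ nij') schur_offdiag.
Qed.

(** * Bounds on the quadratic form of the inverse *)

Lemma quadform_subZ (R : realType) (d : nat) (A : 'M[R]_d) (x y : 'cV[R]_d)
    (c : R) : A^T = A ->
  quadform A (x - c *: y) =
  quadform A x - 2 * c * (x^T *m A *m y) ord0 ord0 + c ^+ 2 * quadform A y.
Proof.
move=> symA; rewrite /quadform.
have crossE : (y^T *m A *m x) ord0 ord0 = (x^T *m A *m y) ord0 ord0.
  suff -> : y^T *m A *m x = (x^T *m A *m y)^T by rewrite mxE.
  by rewrite !trmx_mul trmxK symA mulmxA.
have -> : (x - c *: y)^T = x^T - c *: y^T by rewrite linearB /= linearZ.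
rewrite !(mulmxBl, mulmxBr) -!scalemxAl -!scalemxAr.
move: crossE; move: (x^T *m A *m x) (y^T *m A *m y) (x^T *m A *m y) => xAx yAy xAy.
by move: (y^T *m A *m x) => yAx yAxE; rewrite ![in LHS]mxE yAxE; ring.
Qed.

Lemma quadform_sub_scalar (R : realType) (d : nat) (A : 'M[R]_d) (c : R)
    (x : 'cV[R]_d) :
  quadform (A - c%:M) x = quadform A x - c * quadform 1%:M x.
Proof.
rewrite /quadform mulmxBr mulmxBl mul_mx_scalar mulmx1 -scalemxAl.
by rewrite !mxE.
Qed.

(* Apply [0 <= quadform A (x - c y)], for [A := Sigma] and [A := I], to
   [y := Sigma^-1 x] and the optimal constant [c]. *)
Lemma quadform_invmx_bounds (R : realType) (d : nat) (lm lp : R)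
    (Sigma : 'M[R]_d) (x : 'cV[R]_d) :
  0 < lm -> 0 < lp -> Sigma \in unitmx ->
  loewner_le lm%:M Sigma -> loewner_le Sigma lp%:M ->
  posdef Sigma -> quadform 1%:M x = 1 ->
  lp^-1 <= quadform (invmx Sigma) x <= lm^-1.
Proof.
move=> lm0 lp0 uS [_ leS] [_ geS] [symS posS] x1.
have symV : (invmx Sigma)^T = invmx Sigma by rewrite trmx_inv symS.
set p := quadform _ x; set y := invmx Sigma *m x.
have Sy : Sigma *m y = x by rewrite mulKVmx.
have xy : (x^T *m y) ord0 ord0 = p by rewrite /y mulmxA.
have ySy : quadform Sigma y = p.
  by rewrite /quadform -mulmxA Sy /y trmx_mul symV.
have xSy : (x^T *m Sigma *m y) ord0 ord0 = 1.
  by rewrite -mulmxA Sy -x1 /quadform mulmx1.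
have sqS z : 0 <= quadform Sigma z.
  have [->|/posS/ltW//] := eqVneq z 0.
  by rewrite /quadform mulmx0 mxE.
have sq1 (z : 'cV[R]_d) : 0 <= quadform 1%:M z.
  rewrite /quadform mulmx1 mxE sumr_ge0 // => i _.
  by rewrite !mxE -expr2 sqr_ge0.
have := sqS (x - lp *: y); rewrite quadform_subZ // xSy ySy => Hlp.
have := sq1 (x - lm *: y); rewrite quadform_subZ ?trmx1 // mulmx1 xy x1 => Hlm.
have := leS y; rewrite quadform_sub_scalar ySy => Hy.
have := geS x; rewrite -[_ - _]opprB /quadform mulmxN mulNmx mxE -/(quadform _ _).
rewrite quadform_sub_scalar x1 => Hx; apply/andP; split.
(* [Hlp] reads x^T Sigma x - 2 lp + lp^2 p >= 0, and [Hx] bounds the first term by lp. *)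
- have : 0 <= lp * (p * lp - 1) by lra.
  by rewrite pmulr_rge0 // subr_ge0 -ler_pdivrMr // div1r.
(* [Hlm] reads 1 - 2 lm p + lm^2 |y|^2 >= 0, and [Hy] gives lm |y|^2 <= p, whence lm p <= 1. *)
- have : lm * (lm * quadform 1%:M y) <= lm * p by rewrite ler_pM2l // -subr_ge0.
  by rewrite -div1r ler_pdivlMr //; lra.
Qed.

(** * The scalar minimization problem *)

Lemma clip_bounds (R : realType) (lm lp s : R) :
  lm < lp -> lm <= clip lm lp s <= lp.
Proof. by move=> h; rewrite /clip le_min ge_min le_max !lexx (ltW h). Qed.

(** With t the clipped value and q = 1/t, the gap (s p - ln p) - (s q - ln q) equals (p - q)(s - t)
    + (p t - 1 - ln (p t)), a sum of two nonnegative terms. *)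
Lemma clip_minimizes (R : realType) (lm lp s p : R) :
  0 < lm -> lm < lp -> lp^-1 <= p <= lm^-1 ->
  let q := (clip lm lp s)^-1 in
  s * q - ln q <= s * p - ln p /\
  (s * q - ln q = s * p - ln p -> p = q).
Proof.
move=> lm0 lmp /andP[lep gep].
have lp0 : 0 < lp by lra.
have p0 : 0 < p by apply: lt_le_trans lep; rewrite invr_gt0.
have /andP[tl tr] := clip_bounds _ _ _ s lmp.
set t := clip lm lp s in tl tr *; move=> q.
have t0 : 0 < t by lra.
(* First-order optimality: s - t is the derivative of s p - ln p at q. When it is nonzero, q is an
   endpoint of the interval and p - q has the same sign or vanishes. *)
have slope : 0 <= (p - q) * (s - t).
  rewrite /q /t /clip; have [h1|h1] := leP lm s; last first.
    by rewrite (min_r (ltW lmp)) mulr_le0 ?subr_le0 ?(ltW h1).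
  have [h2|h2] := leP lp s; last by rewrite subrr mulr0.
  by rewrite mulr_ge0 // subr_ge0.
have q0 : 0 < q by rewrite invr_gt0.
have tq : t * q = 1 by rewrite divff ?gt_eqF.
have -> : ln q = - ln t by rewrite lnV.
have pt0 : 0 < p * t by rewrite mulr_gt0.
have lnpt : ln p + ln t = ln (p * t) by rewrite lnM.
have tangent : 1 + ln (p * t) <= p * t.
  by rewrite -{2}[p * t]lnK ?posrE // expR_ge1Dx.
split; first nra.
move=> eqpq.
(* The tangent inequality 1 + w <= exp w is strict unless w = 0, so a zero gap forces p t = 1. *)
have [w0|/expR_gt1Dx] := eqVneq (ln (p * t)) 0; last first.
  by rewrite lnK ?posrE //; nra.
have pt1 : p * t = 1 by rewrite -[LHS]lnK ?posrE // w0 expR0.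
by rewrite /q -[p](mulfK (lt0r_neq0 t0)) pt1 mul1r.
Qed.

(** * Independence of the functional calculus from the decomposition *)

(** Entrywise, the hypothesis says that s_j = r_i wherever W_ij is nonzero; applying g preserves
    this. *)
Lemma intertwine_map_mx (R : idomainType) (d : nat) (g : R -> R)
    (s r : 'rV[R]_d) (W : 'M[R]_d) :
  W *m diag_mx s = diag_mx r *m W ->
  W *m diag_mx (map_mx g s) = diag_mx (map_mx g r) *m W.
Proof.
move=> /matrixP WsrW; apply/matrixP => i j; move: (WsrW i j).
rewrite !mul_mx_diag !mul_diag_mx !mxE.
have [->|nW] := eqVneq (W i j) 0; first by rewrite !mul0r !mulr0.
by rewrite mulrC => /(mulIf nW) ->; rewrite mulrC.
Qed.

(** For two decompositions by U and V, the matrix V^T U intertwines the diagonal factors, hence also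
    their images under g, so the set given to [xget] is a singleton. *)
Lemma functional_calculusE (R : realType) (d : nat) (g : R -> R)
    (S U : 'M[R]_d) (s : 'rV[R]_d) :
  spectral_decomposition S U s ->
  functional_calculus g S = U *m diag_mx (map_mx g s) *m U^T.
Proof.
move=> SUs; apply: xget_unique; first by exists U, s.
move=> _ [V [r [[oV SV] ->]]]; case: SUs => oU SU.
have oU' := mulmx1C oU; have oV' := mulmx1C oV.
pose W := V^T *m U.
have WsrW : W *m diag_mx s = diag_mx r *m W.
  have := congr1 (fun M => V^T *m M *m U) (etrans (esym SU) SV).
  by rewrite !mulmxA oV mul1mx -!mulmxA oU mulmx1 !mulmxA.
have WgsrW := intertwine_map_mx _ _ g _ _ _ WsrW.
have -> : V^T = W *m U^T by rewrite /W -mulmxA oU' mulmx1.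
by rewrite mulmxA -(mulmxA V) -WgsrW /W !mulmxA oV' mul1mx.
Qed.

(** * Matrices with prescribed eigenvectors and eigenvalues *)

Lemma quadform_spectral (R : realType) (d : nat) (U : 'M[R]_d) (t : 'rV[R]_d)
    (x : 'cV[R]_d) :
  quadform (U *m diag_mx t *m U^T) x =
  \sum_j t ord0 j * (U^T *m x) j ord0 ^+ 2.
Proof.
rewrite /quadform; have -> : x^T *m (U *m diag_mx t *m U^T) *m x
    = (U^T *m x)^T *m diag_mx t *m (U^T *m x).
  by rewrite trmx_mul trmxK !mulmxA.
set z := U^T *m x; rewrite mul_mx_diag mxE; apply: eq_bigr => j _.
by rewrite !mxE; ring.
Qed.

Lemma spectral_sym (R : realType) (d : nat) (U : 'M[R]_d) (t : 'rV[R]_d) :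
  (U *m diag_mx t *m U^T)^T = U *m diag_mx t *m U^T.
Proof. by rewrite !trmx_mul trmxK tr_diag_mx mulmxA. Qed.

Lemma possemidef_spectral (R : realType) (d : nat) (U : 'M[R]_d)
    (t : 'rV[R]_d) : (forall j, 0 <= t ord0 j) ->
  possemidef (U *m diag_mx t *m U^T).
Proof.
move=> t0; split; first exact: spectral_sym.
move=> x; rewrite quadform_spectral sumr_ge0 // => j _.
by rewrite mulr_ge0 ?sqr_ge0.
Qed.

Lemma posdef_spectral (R : realType) (d : nat) (U : 'M[R]_d)
    (t : 'rV[R]_d) : orthogonal_mx U -> (forall j, 0 < t ord0 j) ->
  posdef (U *m diag_mx t *m U^T).
Proof.
move=> oU t0; split; first exact: spectral_sym.
have summand0 (x : 'cV_d) j : 0 <= t ord0 j * (U^T *m x) j ord0 ^+ 2.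
  by rewrite mulr_ge0 ?sqr_ge0 // ltW.
move=> x nx0; rewrite quadform_spectral lt0r sumr_ge0 // andbT.
apply: contraNneq nx0 => /psumr_eq0P z0.
rewrite -[x]mul1mx -(mulmx1C oU) -mulmxA.
suff -> : U^T *m x = 0 by rewrite mulmx0.
apply/matrixP => j k; rewrite ord1 [RHS]mxE; apply/eqP.
have /eqP := z0 (fun j _ => summand0 x j) j isT.
by rewrite mulf_eq0 gt_eqF //= sqrf_eq0.
Qed.

Lemma spectral_loewner_interval (R : realType) (d : nat) (lm lp : R)
    (U : 'M[R]_d) (t : 'rV[R]_d) : 0 < lm -> orthogonal_mx U ->
  (forall j, lm <= t ord0 j <= lp) ->
  loewner_interval lm lp (U *m diag_mx t *m U^T).
Proof.
move=> lm0 oU t_in.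
(* Scalar matrices are diagonalized by the same [U], so both Loewner inequalities reduce to
   inequalities between eigenvalues. *)
have scalarE c : c%:M = U *m diag_mx (const_mx c) *m U^T.
  by rewrite diag_const_mx mul_mx_scalar -scalemxAl (mulmx1C oU) scalemx1.
split.
- by apply: posdef_spectral => // j; have /andP[] := t_in j; lra.
- rewrite /loewner_le (scalarE lm) -mulmxBl -mulmxBr -linearB.
  by apply: possemidef_spectral => j; have /andP[] := t_in j; rewrite !mxE; lra.
- rewrite /loewner_le (scalarE lp) -mulmxBl -mulmxBr -linearB.
  by apply: possemidef_spectral => j; have /andP[] := t_in j; rewrite !mxE; lra.
Qed.

Lemma invmx_spectral (R : realType) (d : nat) (U : 'M[R]_d) (t : 'rV[R]_d) :
  orthogonal_mx U -> (forall j, t ord0 j != 0) ->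
  invmx (U *m diag_mx t *m U^T) =
  U *m diag_mx (\row_j (t ord0 j)^-1) *m U^T.
Proof.
move=> oU t0; set A := U *m _ *m _; set B := RHS.
have AB : A *m B = 1%:M.
  rewrite /A /B -!mulmxA (mulmxA U^T) oU mul1mx (mulmxA (diag_mx t)) mulmx_diag.
  rewrite (_ : (\row_j _) = const_mx 1) ?diag_const_mx ?mul1mx ?(mulmx1C oU) //.
  by apply/rowP => j; rewrite !mxE divff.
by have [uA _] := mulmx1_unit AB; rewrite -[RHS](mulKmx uA) AB mulmx1.
Qed.

(** * The objective in terms of the precision matrix *)

Lemma ln_prod (R : realType) (I : finType) (F : I -> R) :
  (forall i, 0 < F i) -> ln (\prod_i F i) = \sum_i ln (F i).
Proof.
(* Positivity of the partial products is carried along because [lnM] requires it. *)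
move=> F0; suff: 0 < \prod_i F i /\ ln (\prod_i F i) = \sum_i ln (F i) by case.
apply: (big_rec2 (fun x y => 0 < x /\ ln x = y)); first by rewrite ln1.
by move=> i x y _ [x0 <-]; rewrite mulr_gt0 ?lnM ?posrE.
Qed.

Lemma logdet_trace_precision (R : realType) (d : nat) (S U : 'M[R]_d)
    (s : 'rV[R]_d) (Sigma : 'M[R]_d) :
  spectral_decomposition S U s -> 0 < \det Sigma ->
  let P := U^T *m invmx Sigma *m U in
  logdet_trace S Sigma = \sum_j s ord0 j * P j j - ln (\det P).
Proof.
move=> [oU SE] detS P; rewrite /logdet_trace.
have -> : \det P = (\det Sigma)^-1.
  rewrite /P !det_mulmx mulrAC -[X in X * _]det_mulmx oU det1 mul1r.
  exact: det_inv.
rewrite lnV ?posrE // opprK addrC; congr (_ + _).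
rewrite SE -!mulmxA mxtrace_mulC -!mulmxA (mulmxA U^T) -/P mul_diag_mx.
by apply: eq_bigr => j _; rewrite mxE.
Qed.

Theorem proposition7p1 (R : realType) (d : nat) (hd : (2 <= d)%N)
    (lm lp : R) (hlm : 0 < lm) (hlp : lm < lp)
    (S : 'M[R]_d) (hS : possemidef S)
    (U : 'M[R]_d) (s : 'rV[R]_d) (hSU : spectral_decomposition S U s)
    (hs : forall j : 'I_d, 0 <= s ord0 j) :
  let Sigma_tilde :=
    U *m diag_mx (\row_(j < d) Num.min lp (Num.max lm (s ord0 j))) *m U^T in
  argmin (logdet_trace S) (loewner_interval lm lp) = [set Sigma_tilde] /\
  Sigma_tilde = functional_calculus (clip lm lp) S.
Proof.
move=> T; have oU := hSU.1; have oU' := mulmx1C oU.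
have clipE : \row_j Num.min lp (Num.max lm (s ord0 j)) = map_mx (clip lm lp) s.
  by apply/rowP => j; rewrite !mxE.
have TE : T = U *m diag_mx (map_mx (clip lm lp) s) *m U^T by rewrite /T clipE.
split; last by rewrite TE (functional_calculusE _ _ _ _ _ _ hSU).
have lp0 : 0 < lp by lra.
have uU : U \in unitmx by have [] := mulmx1_unit oU'.
pose prec Sigma : 'M[R]_d := U^T *m invmx Sigma *m U.
(* Uniqueness can thus be checked on precision matrices. [invmx] fixes singular matrices, so it is
   an involution on all matrices. *)
have prec_inj : injective prec.
  move=> A B /(congr1 (fun M => U *m M *m U^T)); rewrite /prec !mulmxA oU'.
  by rewrite !mul1mx -!mulmxA oU' !mulmx1 => /(congr1 invmx); rewrite !invmxK.
pose q j := (clip lm lp (s ord0 j))^-1.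
have clip0 j : 0 < clip lm lp (s ord0 j).
  by have /andP[] := clip_bounds _ _ _ (s ord0 j) hlp; lra.
have precT : prec T = diag_mx (\row_j q j).
  rewrite /prec TE invmx_spectral //; last by move=> j; rewrite mxE gt_eqF.
  rewrite !mulmxA oU mul1mx -mulmxA oU mulmx1; congr diag_mx.
  by apply/rowP => j; rewrite !mxE.
have KT : loewner_interval lm lp T.
  by rewrite TE; apply: spectral_loewner_interval => // j; rewrite mxE clip_bounds.
pose h j p := s ord0 j * p - ln p.
have fT : logdet_trace S T = \sum_j h j (q j).
  have [posT _ _] := KT; have [detT _ _] := hadamard _ _ _ posT.
  rewrite (logdet_trace_precision _ _ _ _ _ _ hSU detT) -/(prec T) precT.
  rewrite det_diag sumrB; congr (_ - _).
    by apply: eq_bigr => j _; rewrite !mxE eqxx.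
  rewrite ln_prod => [|j]; first by apply: eq_bigr => j _; rewrite mxE.
  by rewrite mxE invr_gt0.
have K_prec Sigma : loewner_interval lm lp Sigma ->
    posdef (prec Sigma) /\ forall j, lp^-1 <= prec Sigma j j <= lm^-1.
  move=> [posS leS geS]; have [detS _ _] := hadamard _ _ _ posS.
  have uS : Sigma \in unitmx by rewrite unitmxE unitfE gt_eqF.
  have posV : posdef (invmx Sigma).
    (* The inverse is congruent to [Sigma] through itself: Sigma^-1 = (Sigma^-1)^T Sigma
       Sigma^-1. *)
    have := posdef_conj _ _ _ (invmx Sigma) _ posS.
    by rewrite unitmx_inv trmx_inv posS.1 mulVmx // mul1mx; apply.
  split=> [|j]; first exact: posdef_conj.
  (* The diagonal entries of [prec Sigma] are values of the quadratic form of Sigma^-1 at the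
     columns of [U], which are unit vectors. *)
  have quadcolE (A : 'M[R]_d) : quadform A (col j U) = (U^T *m A *m U) j j.
    rewrite /quadform colE trmx_mul trmx_delta mulmxA -(mulmxA _ U^T) -(mulmxA _ _ U).
    by rewrite -rowE -colE [LHS]mxE mxE.
  rewrite /prec -quadcolE; apply: quadform_invmx_bounds => //.
  by rewrite quadcolE mulmx1 oU mxE eqxx.
have h_min Sigma : loewner_interval lm lp Sigma ->
    forall j, h j (q j) <= h j (prec Sigma j j).
  move=> /K_prec[_ /[swap] j /(_ j) Pj].
  by have [] := clip_minimizes _ _ _ (s ord0 j) _ hlm hlp Pj.
(* The objective splits into a separable sum and the Hadamard defect of [prec Sigma], which is
   nonnegative and vanishes only for diagonal matrices. *)
have fE Sigma : loewner_interval lm lp Sigma ->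
    logdet_trace S Sigma = \sum_j h j (prec Sigma j j)
      + (\sum_j ln (prec Sigma j j) - ln (\det (prec Sigma))).
  move=> [posS _ _]; have [detS _ _] := hadamard _ _ _ posS.
  rewrite (logdet_trace_precision _ _ _ _ _ _ hSU detS) -/(prec Sigma).
  by rewrite sumrB; ring.
apply/seteqP; split=> [Sigma [KS minS]|_ ->] /=; last first.
  split=> // Sigma KS; have [posP _] := K_prec _ KS.
  have [_ had _] := hadamard _ _ _ posP.
  rewrite fT fE // -[leLHS]addr0 lerD ?subr_ge0 //.
  by apply: ler_sum => j _; exact: h_min.
have [posP boundP] := K_prec _ KS; have [_ had had_eq] := hadamard _ _ _ posP.
have := minS _ KT; rewrite fT fE // => le_f.
have leh := h_min _ KS.
(* By [le_f], the excess of the separable sum plus the Hadamard defect is at most 0. Both are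
   nonnegative, so both vanish: the first fixes the diagonal of [prec Sigma], the second its
   off-diagonal entries. *)
have le_sum : \sum_j h j (q j) <= \sum_j h j (prec Sigma j j).
  by apply: ler_sum => j _; exact: leh.
have eqh : forall j, h j (q j) = h j (prec Sigma j j).
  by apply: sum_le_eq => //; lra.
have offdiag : forall i j, i != j -> prec Sigma i j = 0 by apply: had_eq; lra.
apply: prec_inj; rewrite precT; apply/matrixP => i j; rewrite [RHS]mxE [in RHS]mxE.
have [->|/offdiag->//] := eqVneq i j; rewrite mulr1n.
by have [_] := clip_minimizes _ _ _ (s ord0 j) _ hlm hlp (boundP j); apply; exact: eqh.
Qed.
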